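(* Let $(X,d)$ and $(Y,\varrho)$ be metric spaces. Let $\lambda>0$ and $\kappa>\lambda$ be constants, let $V\subset Y$ and $W\subset X\times Y$ be non-empty sets, and let $F:X\rightrightarrows Y$ be a set-valued mapping such that $\operatorname{gph}F$ is complete and $F(W_X)\cap V\neq\emptyset$. Equip $X\times Y$ with the metric $$\xi((u,v),(x,y)):=\max\{d(u,x),\lambda\,\varrho(v,y)\},\qquad (u,v),(x,y)\in X\times Y.$$ Assume that for each $(u,v)\in\operatorname{gph}F$ and each $y\in W_Y$ such that $$0<\kappa\,\varrho(y,v)\le\kappa\,\varrho(y,\tilde v)-\xi((u,v),(x,\tilde v))\quad\text{for some }x\in W_{\cdot,y}\text{ and }\tilde v\in F(x)\cap V,$$ there is a pair $(\hat u,\hat v)\in\operatorname{gph}F$ satisfying $$\kappa\,\varrho(y,\hat v)<\kappa\,\varrho(y,v)-\xi((\hat u,\hat v),(u,v)).$$ Then $F$ is $V$-restrictedly regular on $W$ with the constant $\kappa$.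
   Context: For $W\subset X\times Y$: $W_X:=\{x\in X:\ (x,y)\in W\text{ for some }y\in Y\}$, $W_Y:=\{y\in Y:\ (x,y)\in W\text{ for some }x\in X\}$, and $W_{\cdot,y}:=\{x\in X:\ (x,y)\in W\}$ for $y\in Y$. For a set-valued mapping $F:X\rightrightarrows Y$: $\operatorname{gph}F=\{(x,y)\in X\times Y: y\in F(x)\}$, $F^{-1}(y)=\{x\in X: y\in F(x)\}$, and $F(A)=\bigcup_{x\in A}F(x)$ for $A\subset X$. Convention: $\inf\emptyset=\infty$, so $\operatorname{dist}(x,C)=\inf\{d(x,u):u\in C\}$ equals $\infty$ if $C=\emptyset$. $F$ is $V$-restrictedly regular on $W$ with the constant $\kappa$ if $\operatorname{dist}(x,F^{-1}(y))\le\kappa\operatorname{dist}(y,F(x)\cap V)$ for each $(x,y)\in W$. *)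

(* Defs.v *)
From HB Require Import structures.
From mathcomp Require Import all_boot all_order all_algebra.
From mathcomp Require Import interval_inference boolp classical_sets.
From mathcomp Require Import reals ereal topology.

Set Implicit Arguments.
Unset Strict Implicit.
Unset Printing Implicit Defensive.

Import Order.TTheory GRing.Theory Num.Theory.

Local Open Scope classical_set_scope.
Local Open Scope ring_scope.

(* [X * Y] already carries the sup metric in the library, so the metric
   max{d, lambda rho} is put on an alias of the product type. *)
Definition wprod (R : realType) (lambda : {posnum R}) (X Y : metricType R) :
  Type := (X * Y)%type.

Section WeightedProduct.
Context (R : realType) (lambda : {posnum R}) (X Y : metricType R).
Local Notation T := (wprod lambda X Y).
Implicit Types p q r : T.

HB.instance Definition _ := Choice.copy T (X * Y)%type.

Definition wdist p q : R :=
  Num.max (mdist p.1 q.1) (lambda%:num * mdist p.2 q.2).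

Lemma wdistxx p : wdist p p = 0.
Proof. by rewrite /wdist !mdistxx mulr0 maxxx. Qed.

Lemma wdist_positivity p q : wdist p q = 0 -> p = q.
Proof.
case: p q => [x y] [x' y']; rewrite /wdist /= => pq0.
have := lexx (0 : R); rewrite -[X in X <= _]pq0 ge_max => /andP[d0].
rewrite pmulr_rle0// => r0; congr pair; apply: mdist_positivity;
  by apply/eqP; rewrite eq_le mdist_ge0 andbT.
Qed.

Lemma wdist_sym p q : wdist p q = wdist q p.
Proof. by rewrite /wdist metric_sym [mdist p.2 _]metric_sym. Qed.

Lemma wdist_triangle q p r : wdist p r <= wdist p q + wdist q r.
Proof.
rewrite /wdist ge_max; apply/andP; split.
  by rewrite (le_trans (metric_triangle _ q.1 _))// lerD// le_max lexx.
rewrite (@le_trans _ _ (lambda%:num * (mdist p.2 q.2 + mdist q.2 r.2)))//.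
  by rewrite ler_pM2l// metric_triangle.
by rewrite mulrDr lerD// le_max lexx orbT.
Qed.

HB.instance Definition _ := @isMetric.Build R T
  wdist wdistxx wdist_positivity wdist_sym wdist_triangle.

End WeightedProduct.
Arguments wdist {R} lambda {X Y} p q.

Definition complete_set (R : realType) (T : metricType R) (A : set T) : Prop :=
  forall u : nat -> T, (forall n, A (u n)) -> cauchy (u @ \oo) ->
    exists2 p, A p & u @ \oo --> p.

Section SetValued.
Context (X Y : Type).
Implicit Types F : X -> set Y.

Definition gph F : set (X * Y) := [set p | F p.1 p.2].

Definition sv_inv F (y : Y) : set X := [set x | F x y].

Definition sv_image F (A : set X) : set Y := \bigcup_(x in A) F x.

End SetValued.

(* [ereal_inf set0 = +oo], so the distance to the empty set is [+oo] *)
Definition dist (R : realType) (X : metricType R) (x : X) (C : set X) : \bar R :=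
  ereal_inf [set (mdist x u)%:E | u in C].

Definition restrictedly_regular (R : realType) (X Y : metricType R)
    (F : X -> set Y) (V : set Y) (W : set (X * Y)) (kappa : R) : Prop :=
  forall x y, W (x, y) ->
    (dist x (sv_inv F y) <= kappa%:E * dist y (F x `&` V))%E.

(* Main.v *)
(** Ekeland's variational principle, applied to [(u, v) |-> kappa * rho(y, v)]
    on the complete set [gph F] from the starting point [(x, vt)], gives a pair
    [(u, v)] of [gph F] with
      [kappa * rho(y, v) + xi((u, v), (x, vt)) <= kappa * rho(y, vt)]
    that no other pair of [gph F] improves upon in the sense of the descent
    condition. So [v = y], hence [F u y] and [d(x, u) <= kappa * rho(y, vt)]. *)
Require Import Defs.
From mathcomp Require Import all_boot all_order all_algebra.
From mathcomp Require Import interval_inference boolp classical_sets.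
From mathcomp Require Import reals ereal topology.
From mathcomp Require Import lra.

Set Implicit Arguments.
Unset Strict Implicit.
Unset Printing Implicit Defensive.

Import Order.TTheory GRing.Theory Num.Theory.

Local Open Scope classical_set_scope.
Local Open Scope ring_scope.

(** The relation [S p q] below is transitive, so greedy descent from [p0] yields nested sets
    [S (u n)]. The values [phi (u n)] decrease and are bounded below, which makes [u] Cauchy; its
    limit lies in every [S (u n)] and is the required point. *)
Lemma ekeland (R : realType) (T : metricType R) (A : set T) (phi : T -> R)
    (b : R) (p0 : T) :
  complete_set A -> (forall p, A p -> b <= phi p) ->
  (forall p a, a < phi p -> \forall q \near p, a < phi q) -> A p0 ->
  exists p, [/\ A p, phi p + mdist p0 p <= phi p0 &
    forall q, A q -> phi p <= phi q + mdist p q].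
Proof.
move=> cA phib lsc Ap0.
pose S p := [set q | A q /\ phi q + mdist p q <= phi p].
(* [next p] at least halves the gap between [phi p] and the infimum of [phi]
   over [S p]. *)
have /choice[next nextP] p : exists q, A p ->
    S p q /\ forall r, S p r -> 2 * phi q <= phi p + phi r.
  have [Ap|nAp] := pselect (A p); last by exists p.
  have Spp : S p p by split; rewrite // mdistxx addr0.
  have hasinf : has_inf (phi @` S p).
    by split; [exists (phi p), p | exists b => _ [q [Aq _] <-]; exact: phib].
  have infle r : S p r -> inf (phi @` S p) <= phi r.
    by move=> Sr; apply: ge_inf; [exact: hasinf.2 | exists r].
  (* If the infimum is below [phi p], a value below the midpoint of the two is attained on [S p];
     otherwise [p] itself serves. *)
  have [lt|ge] := ltP (inf (phi @` S p)) (phi p).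
    have e0 : 0 < (phi p - inf (phi @` S p)) / 2 by lra.
    have [_ [q Sq <-] qlt] := inf_adherent e0 hasinf.
    by exists q => _; split=> // r /infle; lra.
  by exists p => _; split=> // r /infle; lra.
pose u n := iter n next p0.
have Au n : A (u n) by elim: n => //= n /nextP[[]].
have uS n : S (u n) (u n.+1) by case: (nextP _ (Au n)).
have ustep n r : S (u n) r -> 2 * phi (u n.+1) <= phi (u n) + phi r.
  by case: (nextP _ (Au n)) => _; apply.
have Strans p q r : S p q -> S q r -> S p r.
  move=> [_ pq] [Ar qr]; split=> //.
  by have := metric_triangle p q r; lra.
have Sle m n : (m <= n)%N -> S (u m) (u n).
  move=> /subnKC <-; elim: (n - m)%N => [|k IH].
    by rewrite addn0; split; rewrite // mdistxx addr0.
  by rewrite addnS; exact: Strans IH (uS _).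
(* By [Sle], this drop in [phi] also bounds the distance from [u N] to [u n]. *)
have gap e : 0 < e ->
    exists N, forall n, (N <= n)%N -> phi (u N) - phi (u n) < e.
  move=> e0; have hasinf : has_inf (range (phi \o u)).
    by split; [exists (phi (u 0%N)), 0%N | exists b => _ [n _ <-]; exact: phib].
  have [_ [N _ <-] Nlt] := inf_adherent e0 hasinf.
  exists N => n _; suff : inf (range (phi \o u)) <= phi (u n).
    by move: Nlt => /=; lra.
  by apply: ge_inf; [exact: hasinf.2 | exists n].
have [|p Ap up] := cA u Au.
  apply: (cauchy_exP (u @ \oo)) => e e0; have [N Ne] := gap e e0.
  exists (u N); rewrite ballEmdist; exists N => // n /= Nn.
  by have [_] := Sle _ _ Nn; have := Ne _ Nn; lra.
(* Pass to the limit in [S (u m) (u n)]: one half of [e] pays for the distance from [u n] to [p],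
   the other for lower semicontinuity at [p]. *)
have Sup m : S (u m) p.
  split=> //; apply/ler_addgt0Pr => e e0.
  have e20 : 0 < e / 2 by lra.
  have ball_p : \forall n \near \oo, ball p (e / 2) (u n).
    exact: up (nbhsx_ballx _ _ e20).
  have phi_p : \forall n \near \oo, phi p - e / 2 < phi (u n).
    by apply: (up (fun q => phi p - e / 2 < phi q)); apply: lsc; lra.
  have [N _ NP] : \forall n \near \oo,
      ball p (e / 2) (u n) /\ phi p - e / 2 < phi (u n).
    by apply: filterS2 ball_p phi_p.
  have [] := NP (maxn m N) (leq_maxr m N).
  rewrite ballEmdist /= metric_sym.
  have [_] := Sle _ _ (leq_maxl m N).
  by have := metric_triangle (u m) (u (maxn m N)) p; lra.
exists p; split=> //; first by have [] := Sup 0%N.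
move=> q Aq; rewrite leNgt; apply/negP => qp.
(* A better [q] would lie in every [S (u n)]. Then [ustep] bounds [phi (u N.+1) - phi q] by the last
   drop of [phi], which [gap] makes so small that [phi (u N.+1) < phi p], against [Sup N.+1]. *)
have Sq n : S (u n) q by apply: Strans (Sup n) _; split=> //; exact: ltW.
have e0 : 0 < phi p - (phi q + mdist p q) by lra.
have [N /(_ N.+1 (leqnSn N))] := gap _ e0.
have := ustep N q (Sq N).
have [_] := Sup N.+1; have := mdist_ge0 (u N.+1) p; have := mdist_ge0 p q.
lra.
Qed.

Lemma mdist_wprodE (R : realType) (lambda : {posnum R}) (X Y : metricType R)
    (p q : wprod lambda X Y) :
  mdist p q = wdist lambda p q.
Proof. by []. Qed.

Theorem proposition2p7 (R : realType) (X Y : metricType R)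
  (lambda : {posnum R}) (kappa : R) (lambda_lt_kappa : lambda%:num < kappa)
  (V : set Y) (V_neq0 : V !=set0)
  (W : set (X * Y)) (W_neq0 : W !=set0)
  (F : X -> set Y)
  (gphF_complete : complete_set (gph F : set (wprod lambda X Y)))
  (FW_V : sv_image F W.`1 `&` V !=set0)
  (descent : forall (u : X) (v : Y), gph F (u, v) -> forall y : Y, W.`2 y ->
    (exists (x : X) (vt : Y), [/\ ysection W y x, (F x `&` V) vt,
       0 < kappa * mdist y v &
       kappa * mdist y v <= kappa * mdist y vt
         - wdist lambda (u, v) (x, vt)]) ->
    exists (uh : X) (vh : Y), gph F (uh, vh) /\
      kappa * mdist y vh < kappa * mdist y v
        - wdist lambda (uh, vh) (u, v)) :
  restrictedly_regular F V W kappa.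
Proof.
have kappa0 : 0 < kappa by exact: lt_trans lambda_lt_kappa.
(* With [kappa] moved to the left, the right side is a bare infimum, so one [vt] at a time suffices;
   an empty [F x] ∩ [V] leaves nothing to check. *)
move=> x y Wxy; rewrite {2}/dist -lee_pdivrMl//.
apply/ereal_infP => _ [vt FVvt <-]; rewrite lee_pdivrMl// -EFinM.
have lsc (p : wprod lambda X Y) a : a < kappa * mdist y p.2 ->
    \forall q \near p, a < kappa * mdist y q.2.
  (* On this ball [kappa * mdist p.2 q.2] stays below [kappa * mdist y p.2 - a]. *)
  move=> ap; set e := lambda%:num * (kappa * mdist y p.2 - a) / kappa.
  have e0 : 0 < e by rewrite divr_gt0// mulr_gt0// subr_gt0.
  apply: filterS (nbhsx_ballx p e e0) => q.
  rewrite ballEmdist /= => pq.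
  have : lambda%:num * mdist p.2 q.2 < e.
    by apply: le_lt_trans pq; rewrite le_max lexx orbT.
  rewrite /e ltr_pdivlMr// -mulrA ltr_pM2l// metric_sym => ?.
  have : kappa * mdist y p.2 <= kappa * (mdist y q.2 + mdist q.2 p.2).
    by rewrite ler_pM2l// metric_triangle.
  by rewrite mulrDr; lra.
have phi0 (p : wprod lambda X Y) : gph F p -> 0 <= kappa * mdist y p.2.
  by move=> _; rewrite mulr_ge0 ?mdist_ge0 ?ltW.
have [[u v] [Fuv uv_le uv_min]] :=
  ekeland (p0 := (x, vt) : wprod lambda X Y) gphF_complete phi0 lsc FVvt.1.
rewrite mdist_wprodE /= in uv_le.
have [yv0|yv0] := eqVneq (mdist y v) 0; last first.
  (* The starting pair is the witness for [descent]: [uv_le] rearranges to its second inequality. *)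
  have [||uh [vh [Fh lt_vh]]] := descent u v Fuv y; first by exists x.
    exists x, vt; split=> //; first exact/ysectionP.
      by rewrite mulr_gt0// lt0r yv0 mdist_ge0.
    by rewrite wdist_sym lerBrDr.
  have := uv_min (uh, vh) Fh; rewrite mdist_wprodE wdist_sym /=.
  by rewrite leNgt -ltrBrDr lt_vh.
apply: (@le_trans _ _ (mdist x u)%:E).
  by apply: ereal_inf_lbound; exists u => //;
    rewrite /sv_inv/= (mdist_positivity _ _ yv0).
rewrite lee_fin; apply: le_trans uv_le.
by rewrite yv0 mulr0 add0r le_max lexx.
Qed.
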